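(* Let $P:\mathscr X\to\mathscr Y$, $\Lambda\subseteq\mathscr Y$ and $\bar x\in\mathscr X$ with $P(\bar x)\in\Lambda$, where $P$ is continuous near $\bar x$ and $\Lambda$ is closed near $P(\bar x)$. If either directional pseudo-normality or directional quasi-normality holds at $\bar x$, then the set-valued map $G(x)=P(x)-\Lambda$ is metrically subregular at $(\bar x,0)$.
   Context: $\mathscr X,\mathscr Y$ are finite-dimensional Hilbert spaces; $\mathscr Y$ is $m$-dimensional with an orthogonal basis $\{e_1,\dots,e_m\}$, and for $y\in\mathscr Y$ we write $y_i=\langle y,e_i\rangle$; likewise $P_i(x)=\langle P(x),e_i\rangle$. $t_k\downarrow0$ means $t_k>0$ and $t_k\to0$. ''$\Lambda$ is closed near $P(\bar x)$'' means that $\Lambda\cap B$ is closed for some closed ball $B$ centred at $P(\bar x)$. For a set $\Omega$ and $\bar y\in\Omega$: - tangent cone: $T_\Omega(\bar y)=\{d:\exists t_k\downarrow0,\ d_k\to d \text{ with } \bar y+t_kd_k\in\Omega\ \forall k\}$; - regular (Fréchet) normal cone: $\widehat N_\Omega(\bar y)=\{\zeta:\limsup_{y\to\bar y,\,y\in\Omega}\langle\zeta,y-\bar y\rangle/\|y-\bar y\|\le0\}$, with $\widehat N_\Omega(y)=\emptyset$ if $y\notin\Omega$; - limiting normal cone in direction $d$: $N_\Omega(\bar y;d)=\{\zeta:\exists t_k\downarrow0,\ d_k\to d,\ \zeta_k\to\zeta \text{ with } \zeta_k\in\widehat N_\Omega(\bar y+t_kd_k)\ \forall k\}$. Graphical derivative: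 $DP(x)(u)=\{\xi:\exists t_k\downarrow0,\ u_k\to u \text{ with } \lim_k (P(x+t_ku_k)-P(x))/t_k=\xi\}$. Directional limiting coderivative: $D^*P(\bar x;(u,\xi))(\zeta)=\{\eta\in\mathscr X:(\eta,-\zeta)\in N_{\mathrm{gph}P}((\bar x,P(\bar x));(u,\xi))\}$, where $\mathrm{gph}P=\{(x,P(x)):x\in\mathscr X\}$. Extended linearized cone: $\widetilde{\mathcal L}(\bar x)=\{(u,\xi)\in\mathscr X\times\mathscr Y:\xi\in DP(\bar x)(u)\cap T_\Lambda(P(\bar x))\}$. Directional quasi-normality holds at $\bar x$ if for all $(0,0)\ne(u,\xi)\in\widetilde{\mathcal L}(\bar x)$ there exists no $\zeta\neq0$ such that $0\in D^*P(\bar x;(u,\xi))(\zeta)$, $\zeta\in N_\Lambda(P(\bar x);\xi)$, and there exist $(u^k,s^k,\zeta^k)\to(u,P(\bar x),\zeta)$ and $t_k\downarrow0$ such that for all $k$, $\zeta^k\in\widehat N_\Lambda(s^k)$ and $\zeta_i(P_i(\bar x+t_ku^k)-s_i^k)>0$ for every $i$ with $\zeta_i\neq0$. Directional pseudo-normality holds at $\bar x$ if for all $(0,0)\ne(u,\xi)\in\widetilde{\mathcal L}(\bar x)$ there exists no $\zeta\neq0$ such that $0\in D^*P(\bar x;(u,\xi))(\zeta)$, $\zeta\in N_\Lambda(P(\bar x);\xi)$, and there exist $(u^k,s^k,\zeta^k)\to(u,P(\bar x),\zeta)$ and $t_k\downarrow0$ such that for all $k$, $\zeta^k\in\widehat N_\Lambda(s^k)$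 and $\langle\zeta,P(\bar x+t_ku^k)-s^k\rangle>0$. $G(x)=P(x)-\Lambda$ is metrically subregular at $(\bar x,0)$ if there exist $\kappa\ge0$ and a neighborhood $U$ of $\bar x$ such that $d(x,G^{-1}(0))\le\kappa\, d(P(x),\Lambda)$ for all $x\in U$, where $G^{-1}(0)=\{x:P(x)\in\Lambda\}$. *)

(* Defs.v *)
From HB Require Import structures.
From mathcomp Require Import all_boot all_order all_algebra.
From mathcomp Require Import all_classical all_reals all_analysis.
Import Order.TTheory GRing.Theory Num.Theory.
Import numFieldNormedType.Exports.

Set Implicit Arguments.
Unset Strict Implicit.
Unset Printing Implicit Defensive.

Local Open Scope classical_set_scope.
Local Open Scope ring_scope.

(* Real inner product spaces: the topology and the norm are those of the
   underlying normed module, and [innerE] forces the norm to be the one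
   induced by the inner product (so positive definiteness is inherited from
   the norm). *)
HB.mixin Record NormedModule_isInner (R : realType) V of NormedModule R V := {
  inner : V -> V -> R ;
  innerC : forall x y, inner x y = inner y x ;
  inner_linearl : forall (a : R) x y z,
    inner (a *: x + y) z = a * inner x z + inner y z ;
  innerE : forall x, inner x x = `|x| ^+ 2
}.

(* [Vector R V] provides finite dimensionality, hence completeness. *)
#[short(type="finHilbertType")]
HB.structure Definition FinHilbert (R : realType) :=
  { V of Vector R V & NormedModule R V & NormedModule_isInner R V }.

(* The inner product of the product Hilbert space X * Y. The topology that
   MathComp-Analysis puts on X * Y is the product topology, which is the one
   induced by this inner product; its norm, however, is the max norm, so
   the Hilbert norm is recovered below from the inner product. *)
Definition inner_prod (R : realType) (X Y : finHilbertType R)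
    (z w : (X * Y)%type) : R :=
  inner z.1 w.1 + inner z.2 w.2.

Definition norm_of (R : realType) (V : Type) (ip : V -> V -> R) (v : V) : R :=
  Num.sqrt (ip v v).

(* t_k > 0 and t_k -> 0; monotonicity is not required. *)
Definition to0pos (R : realType) (t : nat -> R) : Prop :=
  (forall k, 0 < t k) /\ t @ \oo --> (0 : R).

Section VariationalGeometry.
Context {R : realType} {V : normedModType R}.

Definition tangent_cone (Omega : set V) (ybar : V) : set V :=
  [set d | exists (t : nat -> R) (d_ : nat -> V),
    [/\ to0pos t, d_ @ \oo --> d &
        forall k, Omega (ybar + t k *: d_ k)]].

(* The inner product is a parameter so that the definition applies both to Y
   and to X * Y. When ybar is an isolated point of Omega, the filter is
   improper and the limsup is -oo, so that every zeta is a normal. *)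
Definition regular_normal_cone (ip : V -> V -> R) (Omega : set V) (ybar : V) :
    set V :=
  [set zeta | Omega ybar /\
    (limf_esup (fun y => (ip zeta (y - ybar) / norm_of ip (y - ybar))%:E)
       (within Omega ybar^') <= 0)%E].

Definition dir_normal_cone (ip : V -> V -> R) (Omega : set V) (ybar d : V) :
    set V :=
  [set zeta | exists (t : nat -> R) (d_ zeta_ : nat -> V),
    [/\ to0pos t, d_ @ \oo --> d, zeta_ @ \oo --> zeta &
        forall k,
          regular_normal_cone ip Omega (ybar + t k *: d_ k) (zeta_ k)]].

End VariationalGeometry.

Section ConstraintSystem.
Context {R : realType} {X Y : finHilbertType R}.
Implicit Types (P : X -> Y) (Lambda : set Y) (x u : X) (xi zeta : Y).

Definition graphical_derivative P x u : set Y :=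
  [set xi | exists (t : nat -> R) (u_ : nat -> X),
    [/\ to0pos t, u_ @ \oo --> u &
        (fun k => (t k)^-1 *: (P (x + t k *: u_ k) - P x)) @ \oo --> xi]].

Definition gph P : set (X * Y) := [set (x, P x) | x in [set: X]].

Definition dir_coderivative P x u xi zeta : set X :=
  [set eta | dir_normal_cone (@inner_prod R X Y) (gph P)
               (x, P x) (u, xi) (eta, - zeta)].

Definition ext_linearized_cone P Lambda x : set (X * Y) :=
  [set z | (graphical_derivative P x z.1 `&` tangent_cone Lambda (P x)) z.2].

Definition is_orthogonal_basis m (e : m.-tuple Y) : Prop :=
  basis_of {:Y}%VS e /\
  forall i j : 'I_m, i != j -> inner (tnth e i) (tnth e j) = 0.

Definition coordinate m (e : m.-tuple Y) (y : Y) (i : 'I_m) : R :=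
  inner y (tnth e i).

Definition dir_quasi_normality m (e : m.-tuple Y) P Lambda x : Prop :=
  forall u xi, ext_linearized_cone P Lambda x (u, xi) ->
    (u, xi) <> (0, 0) ->
    ~ exists zeta : Y,
      [/\ zeta <> 0, dir_coderivative P x u xi zeta 0,
          dir_normal_cone inner Lambda (P x) xi zeta &
          exists (u_ : nat -> X) (s_ zeta_ : nat -> Y) (t : nat -> R),
            [/\ u_ @ \oo --> u, s_ @ \oo --> P x, zeta_ @ \oo --> zeta,
                to0pos t &
                forall k,
                  regular_normal_cone inner Lambda (s_ k) (zeta_ k) /\
                  forall i : 'I_m, coordinate e zeta i <> 0 ->
                    0 < coordinate e zeta i *
                        (coordinate e (P (x + t k *: u_ k)) i -
                         coordinate e (s_ k) i)]].

Definition dir_pseudo_normality P Lambda x : Prop :=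
  forall u xi, ext_linearized_cone P Lambda x (u, xi) ->
    (u, xi) <> (0, 0) ->
    ~ exists zeta : Y,
      [/\ zeta <> 0, dir_coderivative P x u xi zeta 0,
          dir_normal_cone inner Lambda (P x) xi zeta &
          exists (u_ : nat -> X) (s_ zeta_ : nat -> Y) (t : nat -> R),
            [/\ u_ @ \oo --> u, s_ @ \oo --> P x, zeta_ @ \oo --> zeta,
                to0pos t &
                forall k,
                  regular_normal_cone inner Lambda (s_ k) (zeta_ k) /\
                  0 < inner zeta (P (x + t k *: u_ k) - s_ k)]].

(* [edist_inf A z] is the (extended real) distance from z to A; both sets
   below are nonempty as soon as P xbar belongs to Lambda. For
   G(x) = P(x) - Lambda, the set G^{-1}(0) is P @^-1` Lambda and d(0, G(x)) is
   d(P(x), Lambda). *)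
Definition metrically_subregular P Lambda (xbar : X) : Prop :=
  exists kappa : R, 0 <= kappa /\
    exists U : set X, nbhs xbar U /\
      forall x, U x ->
        (edist_inf (P @^-1` Lambda) x <= kappa%:E * edist_inf Lambda (P x))%E.

End ConstraintSystem.

(* Main.v *)
Require Import Defs.
From mathcomp Require Import all_boot all_order all_algebra.
From mathcomp Require Import all_classical all_reals all_analysis.
From mathcomp Require Import ring lra.
Import Order.TTheory GRing.Theory Num.Theory.
Import numFieldNormedType.Exports.
Import VectorInternalTheory.
Local Open Scope classical_set_scope.
Local Open Scope ring_scope.

(* If metric subregularity fails, there are points x_k -> xbar whose distance D_k
   to the solution set exceeds k d(P(x_k), Lambda). Minimizing
   |P(x) - s| + c_k |x - x_k|^2 over x in the ball of radius D_k / 2 around x_k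
   and s in Lambda, with c_k = 4 / (k D_k), forces the minimizer (x, s) into the
   interior and keeps P(x) <> s. Hence zeta = (P(x) - s) / |P(x) - s| is a
   regular normal to Lambda at s and (-2 c_k (x - x_k), -zeta) is one to gph P,
   with first component O(1/k). Normalizing (x - xbar, P(x) - P(xbar)) and passing
   to a subsequence gives a critical direction and a multiplier that violate both
   normality conditions at once, because P(x) - s is a positive multiple of zeta. *)

(** * Inner product identities and compactness of closed bounded sets *)

Section InnerProduct.
Context {R : realType} {V : finHilbertType R}.
Implicit Types x y z : V.

Lemma innerDl x y z : inner (x + y) z = inner x z + inner y z.
Proof. by rewrite -[x in x + y]scale1r inner_linearl mul1r. Qed.

Lemma inner0l z : inner (0 : V) z = 0.
Proof. by apply: (addrI (inner 0 z)); rewrite -innerDl !addr0. Qed.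

Lemma innerZl (a : R) x z : inner (a *: x) z = a * inner x z.
Proof. by rewrite -[a *: x]addr0 inner_linearl inner0l addr0. Qed.

Lemma innerNl x z : inner (- x) z = - inner x z.
Proof. by rewrite -scaleN1r innerZl mulN1r. Qed.

Lemma innerDr x y z : inner z (x + y) = inner z x + inner z y.
Proof. by rewrite !(innerC z) innerDl. Qed.

Lemma innerNr x z : inner z (- x) = - inner z x.
Proof. by rewrite !(innerC z) innerNl. Qed.

Lemma sqr_normD x y : `|x + y| ^+ 2 = `|x| ^+ 2 + 2 * inner x y + `|y| ^+ 2.
Proof. rewrite -!innerE innerDl !innerDr (innerC y x); ring. Qed.

(* Polarization expresses the inner product through the continuous norm. *)
Lemma continuous_innerl z : continuous (fun x : V => inner x z).
Proof.
have -> : (fun x : V => inner x z) =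
    (fun x => 2^-1 * (`|x + z| * `|x + z| - `|x| * `|x| - `|z| * `|z|)).
  by apply/funext => x; have := sqr_normD x z; rewrite !expr2 => ->; field.
move=> x.
have cD : `|y + z| @[y --> x] --> `|x + z|.
  by apply: cvg_norm; apply: cvgD; [exact: cvg_id|exact: cvg_cst].
have cx : `|y| @[y --> x] --> `|x| by apply: cvg_norm; exact: cvg_id.
apply: cvgM; first exact: cvg_cst.
by apply: cvgB; [apply: cvgB; apply: cvgM|exact: cvg_cst].
Qed.

Lemma norm_of_inner (v : V) : norm_of inner v = `|v|.
Proof. by rewrite /norm_of innerE sqrtr_sqr ger0_norm. Qed.

(* [r2v] identifies [V] with row vectors; on the compact unit sphere its norm
   is bounded below, so it transfers boundedness back to coordinates. *)
Lemma closed_bounded_compact (A : set V) (r : R) :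
  closed A -> (forall v, A v -> `|v| <= r) -> compact A.
Proof.
move=> Acl Ar.
pose f (a : 'rV[R]_(dim V)) : V := r2v a.
have fZ k a : f (k *: a) = k *: f a by rewrite /f linearZ.
have cf : continuous f.
  have -> : f = (fun a => \sum_i a ord0 i *: f (delta_mx ord0 i)).
    apply/funext => a; rewrite {1}[a]row_sum_delta /f linear_sum.
    by apply: eq_bigr => i _; rewrite linearZ.
  move=> a; apply: (cvg_big (F := nbhs a) add_continuous) => i _.
   apply: cvgZr_tmp.
  exact: coord_continuous.
pose S := [set a : 'rV[R]_(dim V) | `|a| = 1].
have cS : compact S.
  apply: bounded_closed_compact.
    by exists 1; split=> // M M1 a /= ->; exact: ltW.
  have -> : S = Num.norm @^-1` [set 1] by [].
  apply: preimage_closed; first by move=> a _; exact: norm_continuous.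
  exact: closed_eq.
have [mu mu0 fmu] : exists2 mu : R, 0 < mu & forall a, mu * `|a| <= `|f a|.
  have [[a0 Sa0]|S0] := pselect (S !=set0).
    have [||c /set_mem Sc cmin] :=
      @compact_EVT_min _ R (fun a => `|f a|) S _ cS _.
    - by exists a0.
    - apply: continuous_subspaceT => a.
      exact: (continuous_comp (cf a) (@norm_continuous _ _ _)).
    exists `|f c|.
      rewrite normr_gt0; apply/eqP => fc0.
      have c0 : c = 0 by rewrite -[c]r2vK -/(f c) fc0 linear0.
      by move: Sc; rewrite /S /= c0 normr0 => /esym/eqP; rewrite oner_eq0.
    move=> a; have [->|a0'] := eqVneq a 0; first by rewrite normr0 mulr0.
    have na : 0 < `|a| by rewrite normr_gt0.
    have /cmin : `|a|^-1 *: a \in S.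
      by rewrite inE /S /= normrZ ger0_norm ?invr_ge0// mulVf// gt_eqF.
    by rewrite fZ normrZ ger0_norm ?invr_ge0// mulrC ler_pdivlMr.
  (* An empty unit sphere means dimension 0: every [a] is zero and any positive constant serves. *)
  exists 1 => // a; have [->|a0] := eqVneq a 0; first by rewrite normr0 mulr0.
  exfalso; apply: S0; exists (`|a|^-1 *: a).
  by rewrite /S /= normrZ ger0_norm ?invr_ge0// mulVf// normr_eq0.
have -> : A = f @` (f @^-1` A).
  apply/seteqP; split => [v Av|_ [a Aa <-]//].
  by exists (v2r v); rewrite /preimage/= /f v2rK.
apply: continuous_compact; first exact: continuous_subspaceT.
apply: bounded_closed_compact.
  exists (r / mu); split; first exact: num_real.
  move=> M rM a /Ar far; apply: le_trans (ltW rM).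
  by rewrite ler_pdivlMr// mulrC (le_trans (fmu a)).
by apply: preimage_closed => // a _; exact: cf.
Qed.

End InnerProduct.

(** [z (phi n)] is picked within [1 / (n + 1)] of a cluster point. Monotonicity of [phi] is replaced
    by [n <= phi n], which is enough to carry bounds in [1 / (n + 1)] over to the subsequence. *)
Lemma compact_cvg_subsequence (R : realType) (V : normedModType R) (K : set V)
    (z : nat -> V) : compact K -> (forall n, K (z n)) ->
  exists (l : V) (phi : nat -> nat),
    (forall n, (n <= phi n)%N) /\ z (phi n) @[n --> \oo] --> l.
Proof.
move=> cK Kz.
have [|l [_ lz]] := cK (z @ \oo) _.
  by exists 0%N => // n _; exact: Kz.
have /choice[phi phiP] : forall n, exists p, (n <= p)%N /\ `|l - z p| < n.+1%:R^-1.
  move=> n.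
  have zn : (z @ \oo) (z @` [set p | (n <= p)%N]).
    by exists n => // p /= np; exists p.
  have ln : nbhs l (ball l n.+1%:R^-1) by apply: nbhsx_ballx; rewrite invr_gt0.
  have [_ [[p /= np <-]]] := lz _ _ zn ln.
  by rewrite -ball_normE => ?; exists p.
exists l, phi; split => [n|]; first by have [] := phiP n.
apply/cvgrPdist_lt => _/posnumP[e].
near=> n; have [_ /lt_trans] := phiP n; apply.
by near: n; exact: near_infty_natSinv_lt.
Unshelve. all: by end_near. Qed.

(** * Regular normals from quadratic bounds *)

(** The bound makes the difference quotient at most [C] times a norm that tends to 0, so its limsup
    is at most 0. Keeping [ip] abstract covers both [Y] and [X * Y]. *)
Lemma regular_normal_quadratic (R : realType) (V : normedModType R)
    (ip : V -> V -> R) (Omega : set V) (y zeta : V) (C : R) :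
  Omega y -> norm_of ip (z - y) @[z --> y] --> 0 ->
  (\forall z \near y,
     Omega z -> ip zeta (z - y) <= C * norm_of ip (z - y) ^+ 2) ->
  regular_normal_cone ip Omega y zeta.
Proof.
move=> Oy ip0 ipC; split => //; rewrite limf_esupE.
apply/lee_addgt0Pr => e e0; rewrite add0e; apply: ge_ereal_inf.
(* [|C| + 1] dominates [C] and is a legitimate divisor whatever the sign of [C]. *)
have C1 : 0 < `|C| + 1 by rewrite ltr_wpDl.
pose W := [set z | ip zeta (z - y) / norm_of ip (z - y) <= e].
exists (ereal_sup [set (ip zeta (z - y) / norm_of ip (z - y))%:E | z in W]).
  exists W => //; rewrite /within /=.
  have small : \forall z \near y, norm_of ip (z - y) < e / (`|C| + 1).
    by apply: (cvgr_lt 0 ip0); rewrite divr_gt0.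
  apply: (@nbhs_dnbhs _ y); near=> z => Oz; rewrite /W /=.
  have := sqrtr_ge0 (ip (z - y) (z - y)); rewrite -/(norm_of ip _) le_eqVlt.
  (* For an abstract [ip] the norm may vanish; the quotient is then 0, since the inverse of 0 is
     0. *)
  case/predU1P => [<-|n0]; first by rewrite invr0 mulr0 ltW.
  rewrite ler_pdivrMr//.
  have Hz : Omega z -> ip zeta (z - y) <= C * norm_of ip (z - y) ^+ 2.
    by near: z.
  apply: (le_trans (Hz Oz)); rewrite expr2 mulrA ler_wpM2r//; first exact: ltW.
  have : norm_of ip (z - y) < e / (`|C| + 1) by near: z.
  rewrite ltr_pdivlMr// => /ltW; apply: le_trans.
  have := ler_norm C; nra.
by apply: ge_ereal_sup => _ [z Wz <-]; rewrite lee_fin.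
Unshelve. all: by end_near. Qed.

Section ProductNorm.
Context {R : realType} {X Y : finHilbertType R}.

Lemma norm_of_inner_prod (z : X * Y) :
  norm_of (@inner_prod R X Y) z = Num.sqrt (`|z.1| ^+ 2 + `|z.2| ^+ 2).
Proof. by rewrite /norm_of /inner_prod !innerE. Qed.

Lemma sqr_norm_of_inner_prod (z : X * Y) :
  norm_of (@inner_prod R X Y) z ^+ 2 = `|z.1| ^+ 2 + `|z.2| ^+ 2.
Proof. by rewrite norm_of_inner_prod sqr_sqrtr// addr_ge0// sqr_ge0. Qed.

(** Compatibility of the Hilbert norm with the product topology, as [regular_normal_quadratic]
    requires; the norm of the library on [X * Y] is the max norm. *)
Lemma cvg_norm_of_inner_prod (y : X * Y) :
  norm_of (@inner_prod R X Y) (z - y) @[z --> y] --> 0.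
Proof.
under eq_fun do rewrite norm_of_inner_prod !expr2.
have -> : (0 : R) =
    Num.sqrt (`|(y - y).1| * `|(y - y).1| + `|(y - y).2| * `|(y - y).2|).
  by rewrite subrr /= !normr0 mulr0 addr0 sqrtr0.
have cB : z - y @[z --> y] --> y - y.
  by apply: cvgB; [exact: cvg_id|exact: cvg_cst].
have c1 : `|(z - y).1| @[z --> y] --> `|(y - y).1|.
  apply: cvg_norm; apply: (cvg_comp _ _ cB).
  exact: (@cvg_fst _ _ (nbhs _) (nbhs _)).
have c2 : `|(z - y).2| @[z --> y] --> `|(y - y).2|.
  apply: cvg_norm; apply: (cvg_comp _ _ cB).
  exact: (@cvg_snd _ _ (nbhs _) (nbhs _)).
exact: (cvg_comp _ _ (cvgD (cvgM c1 c1) (cvgM c2 c2)) (@sqrt_continuous R _)).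
Qed.

End ProductNorm.

(** Squaring the minimality of [s] and expanding around it gives [2 <y - s, s' - s> <= |s' - s|^2];
    dividing by [2 |y - s|] yields the constant of the quadratic bound. *)
Lemma regular_normal_nearest (R : realType) (Y : finHilbertType R)
    (Lambda : set Y) (y s : Y) :
  Lambda s -> y != s ->
  (\forall s' \near s, Lambda s' -> `|y - s| <= `|y - s'|) ->
  regular_normal_cone inner Lambda s (`|y - s|^-1 *: (y - s)).
Proof.
move=> Ls ys near_s.
have n0 : 0 < `|y - s| by rewrite normr_gt0 subr_eq0.
apply: (@regular_normal_quadratic _ _ _ _ _ _ (`|y - s|^-1 / 2)) => //.
  under eq_fun do rewrite norm_of_inner.
  have -> : (0 : R) = `|s - s| by rewrite subrr normr0.
  by apply: cvg_norm; apply: cvgB; [exact: cvg_id|exact: cvg_cst].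
apply: filterS near_s => s' min_s Ls'; rewrite norm_of_inner innerZl -mulrA.
rewrite ler_wpM2l ?invr_ge0//.
have /(lerXn2r 2) := min_s Ls'; rewrite !nnegrE !normr_ge0 => /(_ isT isT).
have -> : y - s' = (y - s) + - (s' - s) by rewrite opprB addrA subrK.
rewrite (sqr_normD (y - s)) innerNr normrN; lra.
Qed.

(* AM-GM, [2 N |y' - s| <= |y' - s|^2 + N^2] with [N = |y - s|], replaces the
   norm by a quadratic that touches it at [y]. *)
Lemma regular_normal_gph (R : realType) (X Y : finHilbertType R) (P : X -> Y)
    (x0 x : X) (s : Y) (c : R) :
  0 <= c -> P x != s ->
  (\forall x' \near x, `|P x - s| + c * `|x - x0| ^+ 2 <=
                       `|P x' - s| + c * `|x' - x0| ^+ 2) ->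
  regular_normal_cone (@inner_prod R X Y) (gph P) (x, P x)
    (- (2 * c) *: (x - x0), - (`|P x - s|^-1 *: (P x - s))).
Proof.
move=> c0 Pxs min_x.
have n0 : 0 < `|P x - s| by rewrite normr_gt0 subr_eq0.
have gP : gph P (x, P x) by exists x.
apply: (regular_normal_quadratic _ _ _ _ _ _ (c + (2 * `|P x - s|)^-1) gP
  (cvg_norm_of_inner_prod (x, P x))).
have near_fst : \forall z \near (x, P x), `|P x - s| + c * `|x - x0| ^+ 2 <=
    `|P z.1 - s| + c * `|z.1 - x0| ^+ 2.
  exact: (@cvg_fst _ _ (nbhs x) (nbhs (P x)) _ _ min_x).
apply: filterS near_fst => -[x' y'] /= min_x' [_ _ [-> eqy']].
move: min_x'; rewrite -eqy' sqr_norm_of_inner_prod /inner_prod /= innerNl !innerZl.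
have -> : x' - x0 = (x - x0) + (x' - x) by rewrite [RHS]addrC addrA subrK.
have eqy : P x' - s = (P x - s) + (P x' - P x) by rewrite [RHS]addrC addrA subrK.
have := sqr_normD (P x - s) (P x' - P x); rewrite -eqy.
rewrite (sqr_normD (x - x0)).
move: (inner (x - x0) (x' - x)) (inner (P x - s) (P x' - P x)) => a b.
move: `|P x' - s| `|P x - s| n0 => M N N0 eqM.
have amgm : M <= N + N^-1 * b + `|P x' - P x| ^+ 2 * (2 * N)^-1.
  have -> : N + N^-1 * b + `|P x' - P x| ^+ 2 * (2 * N)^-1 =
    (M ^+ 2 + N ^+ 2) / (2 * N) by rewrite eqM; field; rewrite gt_eqF.
  rewrite ler_pdivlMr ?mulr_gt0//; have := sqr_ge0 (M - N); nra.
(* Minimality now reads [N <= M + 2 c a + c g]. Adding [amgm] bounds the pairing [- 2 c a - b'] by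
   [c g + i h], which is at most [(c + i) (g + h)]. *)
move: (`|P x' - P x| ^+ 2) (sqr_ge0 `|P x' - P x|) amgm => h h0.
move: (N^-1 * b) => b'.
have iN : 0 < (2 * N)^-1 by rewrite invr_gt0 mulr_gt0.
move: ((2 * N)^-1) iN => i i0 amgm.
move: (`|x' - x| ^+ 2) (sqr_ge0 `|x' - x|) => g g0.
nra.
Qed.

(** * Failure of metric subregularity and penalized minimization *)

Lemma near_dist_lt (R : realType) (V : normedModType R) (x : V) (e : R) :
  0 < e -> \forall y \near x, `|x - y| < e.
Proof. by move=> /(nbhsx_ballx x); rewrite -ball_normE. Qed.

Lemma edist_infP (R : realType) (V : normedModType R) (A : set V) (x a : V)
    (D : R) : edist_inf A x = D%:E -> A a -> D <= `|x - a|.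
Proof.
move=> AD Aa; apply/ler_addgt0Pr => e e0; rewrite -lee_fin -AD.
apply: (@le_trans _ _ (edist (x, a))); first by apply: ereal_inf_lbound; exists a.
apply: edist_fin; first by rewrite ltr_wpDl.
by rewrite -ball_normE /ball_ /= ltrDl.
Qed.

(** The negated definition is tested with [kappa = k] and the ball of radius [d]. The distance [D]
    to the solution set is finite because [xbar] belongs to it, and the strict gap leaves room for
    an actual point [s] of [Lambda] in place of the infimum. *)
Lemma not_metrically_subregular (R : realType) (X Y : finHilbertType R)
    (P : X -> Y) (Lambda : set Y) (xbar : X) (k d : R) :
  Lambda (P xbar) -> ~ metrically_subregular P Lambda xbar ->
  0 < k -> 0 < d ->
  exists x s D, [/\ `|x - xbar| < d, Lambda s, k * `|P x - s| < D &
                    forall x', Lambda (P x') -> D <= `|x - x'|].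
Proof.
move=> Lx nreg k0 d0; apply: contrapT => nex; apply: nreg.
exists k; split; first exact: ltW.
exists (ball xbar d); split; first exact: nbhsx_ballx.
move=> x; rewrite -ball_normE /ball_ /= distrC => xd.
rewrite leNgt; apply/negP => lt_inf; apply: nex.
have [D invD] : exists D, edist_inf (P @^-1` Lambda) x = D%:E.
  exists (fine (edist_inf (P @^-1` Lambda) x)); rewrite fineK//.
  rewrite ge0_fin_numE ?edist_inf_ge0//.
  apply: (@le_lt_trans _ _ (edist (x, xbar))); last first.
    rewrite -ge0_fin_numE ?edist_ge0//; apply/edist_finP.
    by exists d => //; rewrite -ball_normE.
  by apply: ereal_inf_lbound; exists xbar.
have : (edist_inf Lambda (P x) < (D / k)%:E)%E.
  rewrite -(@lte_pmul2l _ k%:E) ?fin_numE// -?EFinM ?lte_fin//.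
  by rewrite mulrC divfK ?gt_eqF// -invD.
move=> /ereal_inf_lt[_ [s Ls <-]] /edist_lt_ball; rewrite -ball_normE => Pxs.
exists x, s, D; split => // [|x' Lx'].
  by rewrite mulrC -ltr_pdivlMr.
exact: edist_infP invD _.
Qed.

(* A minimizer [(x, s)] of [|P x' - s'| + c |x' - x0|^2] over a small ball around
   a point [x0] where the error bound fails gives exact normals; the quadratic
   penalty is smooth, so no fuzzy sum rule or Ekeland principle is needed. *)
Lemma approximate_multiplier (R : realType) (X Y : finHilbertType R)
    (P : X -> Y) (Lambda : set Y) (xbar : X) (r eps : R) :
  Lambda (P xbar) ->
  (\forall x \near xbar, {for x, continuous P}) ->
  0 < r -> closed (Lambda `&` closed_ball (P xbar) r) ->
  ~ metrically_subregular P Lambda xbar -> 0 < eps ->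
  exists x s eta,
    [/\ [/\ x != xbar, `|x - xbar| < eps & `|P x - P xbar| < eps],
        [/\ P x != s, `|P x - s| <= eps * `|x - xbar| & `|eta| <= eps],
        regular_normal_cone inner Lambda s (`|P x - s|^-1 *: (P x - s)) &
        regular_normal_cone (@inner_prod R X Y) (gph P) (x, P x)
          (eta, - (`|P x - s|^-1 *: (P x - s)))].
Proof.
move=> Lx contP r0 clL nreg eps0.
have r4 : 0 < r / 4 by rewrite divr_gt0.
have /nbhs_ballP[d0 /= d00 near_xbar] : \forall x \near xbar,
    [/\ {for x, continuous P}, `|P x - P xbar| < eps & `|P x - P xbar| < r / 4].
  have cP : {for xbar, continuous P} by exact: nbhs_singleton contP.
  have near_P e : 0 < e -> \forall x \near xbar, `|P x - P xbar| < e.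
    move=> e0; move/cvgrPdist_lt : cP => /(_ _ e0).
    by apply: filterS => x; rewrite distrC.
  near=> x; split; near: x; [exact: contP|exact: near_P|exact: near_P].
pose d := Num.min d0 (Num.min eps (r / 4)).
have d_gt0 : 0 < d by rewrite !lt_min d00 eps0.
have nearP x : `|x - xbar| < d ->
    [/\ {for x, continuous P}, `|P x - P xbar| < eps & `|P x - P xbar| < r / 4].
  rewrite lt_min => /andP[xd _]; apply: near_xbar.
  by rewrite -ball_normE /ball_ /= distrC.
(* Two properties matter: [1 <= k], and [4 <= eps * k], which turns bounds of order [1 / k] into
   bounds by [eps]. *)
pose k := 1 + 4 / eps.
have k1 : 1 <= k by rewrite lerDl divr_ge0// ltW.
have k_gt0 : 0 < k by exact: lt_le_trans k1.
have k4 : 4 <= eps * k.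
  by rewrite /k mulrDr mulr1 [eps * _]mulrC divfK ?gt_eqF// lerDr ltW.
(* Since [D <= |x0 - xbar| < d / 2], the ball of radius [D / 2] around [x0] stays within [d] of
   [xbar]. *)
have [|x0 [s0 [D [x0d Ls0 s0D Dmin]]]] :=
  @not_metrically_subregular R X Y P Lambda xbar k (d / 2) Lx nreg k_gt0.
  by rewrite divr_gt0.
have Dx0 : D <= `|x0 - xbar| by exact: Dmin.
have D0 : 0 < D by apply: le_lt_trans s0D; rewrite mulr_ge0// ltW.
have d_r : d <= r / 4 by rewrite !ge_min lexx !orbT.
have d_eps : d <= eps by rewrite !ge_min lexx !orbT.
have D2 : 0 < D / 2 by rewrite divr_gt0.
have s0D' : `|P x0 - s0| < D.
  by apply: le_lt_trans s0D; rewrite ler_peMl.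
pose B : set X := closed_ball_ Num.norm x0 (D / 2).
pose L := Lambda `&` closed_ball (P xbar) r.
have Bd x : B x -> `|x - xbar| < d.
  rewrite /B /closed_ball_ /= => Bx.
  have := ler_distD x0 x xbar; rewrite (distrC x x0) => tri.
  by apply: (le_lt_trans tri); lra.
have LE s : L s <-> Lambda s /\ `|P xbar - s| <= r.
  by rewrite /L closed_ballE.
have cB : compact B.
  apply: (@closed_bounded_compact _ _ _ (`|x0| + D / 2)).
    exact: closed_closed_ball_.
  move=> x; rewrite /B /closed_ball_ /= => Bx.
  have := ler_normD x0 (x - x0); rewrite addrC subrK => /le_trans; apply.
  by rewrite lerD2l distrC.
have cL : compact L.
  apply: (@closed_bounded_compact _ _ _ (`|P xbar| + r)) => // s /LE[_ sr].
  have := ler_normD (P xbar) (s - P xbar); rewrite addrC subrK => /le_trans; apply.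
  by rewrite lerD2l distrC.
(* Chosen so that [c (D / 2)^2 = D / k], which exceeds the value [|P x0 - s0|] of [f] at [(x0, s0)];
   hence no minimizer lies on the sphere of radius [D / 2]. Also [2 c (D / 2) = 4 / k <= eps] bounds
   the normal in [X]. *)
pose c := 4 / (k * D).
have kD : 0 < k * D by rewrite mulr_gt0.
have c0 : 0 < c by rewrite divr_gt0.
have c2 : 0 < 2 * c by rewrite pmulr_rgt0.
pose f (z : X * Y) := `|P z.1 - z.2| + c * `|z.1 - x0| ^+ 2.
have Ls0' : L s0.
  apply/LE; split => //.
  have [_ _ Px0] : [/\ {for x0, continuous P}, `|P x0 - P xbar| < eps &
      `|P x0 - P xbar| < r / 4] by apply: nearP; lra.
  have := ler_distD (P x0) (P xbar) s0; rewrite (distrC (P xbar) (P x0)) => tri.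
  by apply: (le_trans tri); lra.
have Bx0 : B x0 by rewrite /B /closed_ball_ /= subrr normr0 divr_ge0// ltW.
have [||[x s] /set_mem[/= Bx Ls] fmin] :=
  @compact_EVT_min _ R f (B `*` L) _ (compact_setX cB cL) _.
- by exists (x0, s0).
- apply: continuous_in_subspaceT => -[x s] /set_mem[/= Bx _].
  have [cPx _ _] := nearP _ (Bd _ Bx).
  have c1 : z.1 @[z --> (x, s)] --> x by exact: (@cvg_fst _ _ (nbhs x) (nbhs s)).
  have cs : z.2 @[z --> (x, s)] --> s by exact: (@cvg_snd _ _ (nbhs x) (nbhs s)).
  have cN : `|z.1 - x0| @[z --> (x, s)] --> `|x - x0|.
    by apply: cvg_norm; apply: cvgB => //; exact: cvg_cst.
  rewrite /continuous_at /f; under eq_fun do rewrite expr2.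
  rewrite expr2; apply: cvgD.
    by apply: cvg_norm; apply: cvgB => //; exact: (cvg_comp _ _ c1 cPx).
  by apply: cvgM; [exact: cvg_cst|exact: cvgM].
have {}fmin x' s' : B x' -> L s' -> f (x, s) <= f (x', s').
  by move=> Bx' Ls'; apply: fmin; rewrite inE; split.
have [_ Pxe Pxr] := nearP _ (Bd _ Bx).
have f0 : `|P x - s| + c * `|x - x0| ^+ 2 <= `|P x0 - s0|.
  have := fmin x0 s0 Bx0 Ls0'.
  by rewrite /f /= subrr normr0 expr0n /= mulr0 addr0.
have xx0 : `|x - x0| < D / 2.
  rewrite ltNge; apply/negP => xx0.
  have /(lerXn2r 2) := xx0.
  rewrite !nnegrE normr_ge0 (ltW D2) => /(_ isT isT) xx0'.
  have cD : k * (c * (D / 2) ^+ 2) = D.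
    by rewrite /c; field; rewrite !gt_eqF.
  have := ler_wpM2l (ltW c0) xx0'; rewrite -(ler_pM2l k_gt0) cD.
  have := ler_wpM2l (ltW k_gt0) f0; rewrite mulrDr.
  have : 0 <= k * `|P x - s| by rewrite mulr_ge0// ltW.
  lra.
have cx0 : 0 <= c * `|x - x0| ^+ 2 by rewrite mulr_ge0// ?ltW// sqr_ge0.
have PxsD : k * `|P x - s| < D.
  apply: le_lt_trans s0D; rewrite ler_pM2l//; lra.
have xxb : D / 2 <= `|x - xbar|.
  by have := ler_distD x x0 xbar; rewrite (distrC x0 x); lra.
have [Lams _] := (LE s).1 Ls.
(* Equality would make [x] a solution closer than [D] to [x0]. *)
have Pxs : P x != s.
  apply/eqP => eqs; have := Dmin x; rewrite eqs distrC => /(_ Lams); lra.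
have Pxs_D : `|P x - s| < D by apply: le_lt_trans PxsD; rewrite ler_peMl.
exists x, s, (- (2 * c) *: (x - x0)); split.
- split=> //; last exact: lt_le_trans (Bd _ Bx) d_eps.
  by rewrite -subr_eq0 -normr_gt0; lra.
- split=> //.
    have : k * `|P x - s| <= k * (eps * `|x - xbar|).
      rewrite mulrA (mulrC k); have := ler_wpM2r (normr_ge0 (x - xbar)) k4; lra.
    by rewrite ler_pM2l.
  rewrite normrZ normrN gtr0_norm//.
  have : 2 * c * `|x - x0| <= 2 * c * (D / 2).
    by rewrite ler_pM2l// ltW.
  have -> : 2 * c * (D / 2) = 4 / k by rewrite /c; field; rewrite !gt_eqF.
  by move=> /le_trans; apply; rewrite ler_pdivrMr.
- apply: regular_normal_nearest => //.
  (* The truncation of [Lambda] is inactive near [s]: [|s' - P xbar|] is below [r / 4 + D + r / 4],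
     and [D < r / 8]. *)
  near=> s' => Ls'.
  have : L s'.
    apply/LE; split => //.
    have ss' : `|s - s'| < r / 4 by near: s'; exact: near_dist_lt.
    have t1 := ler_distD (P x) (P xbar) s'.
    have t2 := ler_distD s (P x) s'.
    rewrite (distrC (P xbar) (P x)) in t1; lra.
  by move=> /(fmin x _ Bx); rewrite /f /= lerD2r.
- apply: regular_normal_gph => //; first exact: ltW.
  have nx : \forall x' \near x, `|x - x'| < D / 2 - `|x - x0|.
    by apply: near_dist_lt; rewrite subr_gt0.
  apply: filterS nx => x' xx'.
  have Bx' : B x'.
    rewrite /B /closed_ball_ /=.
    by have := ler_distD x x0 x'; rewrite (distrC x0 x); lra.
  exact: (fmin x' s Bx' Ls).
Unshelve. all: by end_near. Qed.

(** * Passage to the limit: critical direction and multiplier *)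

Lemma cvg0_le_harmonic (R : realType) (V : normedModType R) (a : nat -> V)
    (C : R) : (forall n, `|a n| <= C * n.+1%:R^-1) -> a @ \oo --> (0 : V).
Proof.
move=> aC; apply/cvgr0Pnorm_lt => e e0.
have cC : C * n.+1%:R^-1 @[n --> \oo] --> (0 : R).
  by rewrite -[0](mulr0 C); apply: cvgM; [exact: cvg_cst|exact: cvg_harmonic].
near=> n; apply: (le_lt_trans (aC n)).
by near: n; exact: (cvgr_lt 0 cC).
Unshelve. all: by end_near. Qed.

Lemma compact_unit_ball (R : realType) (V : finHilbertType R) :
  compact [set v : V | `|v| <= 1].
Proof.
apply: (@closed_bounded_compact _ _ _ 1) => //.
have -> : [set v : V | `|v| <= 1] = Num.norm @^-1` [set r | r <= 1] by [].
by apply: preimage_closed; [move=> ? _; exact: norm_continuous|exact: closed_le].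
Qed.

(* The common core of both normality conditions: the last clause yields the sign
   condition of pseudo-normality by pairing with [zeta], and that of
   quasi-normality by taking coordinates. *)
Lemma critical_multiplier (R : realType) (X Y : finHilbertType R)
    (P : X -> Y) (Lambda : set Y) (xbar : X) (r : R) :
  Lambda (P xbar) ->
  (\forall x \near xbar, {for x, continuous P}) ->
  0 < r -> closed (Lambda `&` closed_ball (P xbar) r) ->
  ~ metrically_subregular P Lambda xbar ->
  exists u xi zeta,
    [/\ ext_linearized_cone P Lambda xbar (u, xi) /\ (u, xi) <> (0, 0),
        `|zeta| = 1, dir_coderivative P xbar u xi zeta 0,
        dir_normal_cone inner Lambda (P xbar) xi zeta &
        exists (u_ : nat -> X) (s_ zeta_ : nat -> Y) (t : nat -> R),
          [/\ u_ @ \oo --> u, s_ @ \oo --> P xbar, zeta_ @ \oo --> zeta,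
              to0pos t &
              forall k, regular_normal_cone inner Lambda (s_ k) (zeta_ k) /\
                exists2 a : R, 0 < a &
                  P (xbar + t k *: u_ k) - s_ k = a *: zeta_ k]].
Proof.
move=> Lx contP r0 clL nreg.
have /choice[w wP] : forall n, exists w : X * Y * X,
    let x := w.1.1 in let s := w.1.2 in
    [/\ [/\ x != xbar, `|x - xbar| < n.+1%:R^-1 & `|P x - P xbar| < n.+1%:R^-1],
        [/\ P x != s, `|P x - s| <= n.+1%:R^-1 * `|x - xbar| &
            `|w.2| <= n.+1%:R^-1],
        regular_normal_cone inner Lambda s (`|P x - s|^-1 *: (P x - s)) &
        regular_normal_cone (@inner_prod R X Y) (gph P) (x, P x)
          (w.2, - (`|P x - s|^-1 *: (P x - s)))].
  move=> n; have n0 : 0 < n.+1%:R^-1 :> R by rewrite invr_gt0.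
  have [x [s [eta H]]] := @approximate_multiplier R X Y P Lambda xbar r n.+1%:R^-1
    Lx contP r0 clL nreg n0.
  by exists (x, s, eta).
pose x n := (w n).1.1; pose s n := (w n).1.2; pose eta n := (w n).2.
pose zeta n := `|P (x n) - s n|^-1 *: (P (x n) - s n).
have {}wP n :
    [/\ [/\ x n != xbar, `|x n - xbar| < n.+1%:R^-1 &
            `|P (x n) - P xbar| < n.+1%:R^-1],
        [/\ P (x n) != s n, `|P (x n) - s n| <= n.+1%:R^-1 * `|x n - xbar| &
            `|eta n| <= n.+1%:R^-1],
        regular_normal_cone inner Lambda (s n) (zeta n) &
        regular_normal_cone (@inner_prod R X Y) (gph P) (x n, P (x n))
          (eta n, - zeta n)].
  exact: wP.
(* This scaling gives [|u n| + |xi n| = 1], so the limit direction cannot be [(0, 0)]. *)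
pose tau n := `|x n - xbar| + `|P (x n) - P xbar|.
have xx n : 0 < `|x n - xbar|.
  by have [[xn _ _] _ _ _] := wP n; rewrite normr_gt0 subr_eq0.
have tau0 n : 0 < tau n by rewrite ltr_pwDl.
pose u n := (tau n)^-1 *: (x n - xbar).
pose xi n := (tau n)^-1 *: (P (x n) - P xbar).
have Pxs n : 0 < `|P (x n) - s n|.
  by have [_ [xn _ _] _ _] := wP n; rewrite normr_gt0 subr_eq0.
have norm_uxi n : `|u n| + `|xi n| = 1.
  by rewrite !normrZ -mulrDr gtr0_norm ?invr_gt0// mulVf// gt_eqF.
have norm_zeta n : `|zeta n| = 1.
  by rewrite normrZ gtr0_norm ?invr_gt0// mulVf// gt_eqF.
have [|[[u0 xi0] zeta0] [phi [phin cvg_phi]]] := @compact_cvg_subsequence R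
    (X * Y * Y)%type _ (fun n => (u n, xi n, zeta n))
    (compact_setX (compact_setX (compact_unit_ball R X) (compact_unit_ball R Y))
       (compact_unit_ball R Y)).
  move=> n; have := norm_uxi n; have := normr_ge0 (u n).
  have := normr_ge0 (xi n) => ? ? ?.
  by split; [split|]; rewrite /= ?norm_zeta//; lra.
have cuxi : (u (phi n), xi (phi n)) @[n --> \oo] --> (u0, xi0).
  exact: (cvg_comp _ _ cvg_phi (@cvg_fst _ _ (nbhs (u0, xi0)) (nbhs zeta0) _)).
have czeta : zeta (phi n) @[n --> \oo] --> zeta0.
  exact: (cvg_comp _ _ cvg_phi (@cvg_snd _ _ (nbhs (u0, xi0)) (nbhs zeta0) _)).
have cu : u (phi n) @[n --> \oo] --> u0.
  exact: (cvg_comp _ _ cuxi (@cvg_fst _ _ (nbhs u0) (nbhs xi0) _)).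
have cxi : xi (phi n) @[n --> \oo] --> xi0.
  exact: (cvg_comp _ _ cuxi (@cvg_snd _ _ (nbhs u0) (nbhs xi0) _)).
have phi_le n : (phi n).+1%:R^-1 <= n.+1%:R^-1 :> R.
  by rewrite lef_pV2 ?posrE// ler_nat ltnS.
have ctau : tau (phi n) @[n --> \oo] --> (0 : R).
  apply: (@cvg0_le_harmonic R R^o _ 2) => n; rewrite gtr0_norm//.
  have [[_ /ltW x1 /ltW x2] _ _ _] := wP (phi n).
  have le_n := phi_le n.
  by rewrite mulr_natl mulr2n lerD//; [exact: le_trans x1 _|exact: le_trans x2 _].
have t0 : to0pos (fun n => tau (phi n)) by split.
have ceta : eta (phi n) @[n --> \oo] --> (0 : X).
  apply: (@cvg0_le_harmonic R X _ 1) => n; rewrite mul1r.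
  by have [_ [_ _ ?] _ _] := wP (phi n); exact: le_trans (phi_le n).
(* The gap [|P (x n) - s n|] is at most [tau n / (n + 1)], so the directions towards [s n] have the
   same limit as [xi]. They witness both the tangent cone and the directional normal cone of
   [Lambda]. *)
pose d n := (tau n)^-1 *: (s n - P xbar).
have cd : d (phi n) @[n --> \oo] --> xi0.
  have -> : (fun n => d (phi n)) =
      (fun n => xi (phi n) + (tau (phi n))^-1 *: (s (phi n) - P (x (phi n)))).
    by apply/funext => n; rewrite /xi -scalerDr addrC addrA subrK.
  rewrite -[xi0]addr0; apply: cvgD => //.
  apply: (@cvg0_le_harmonic R Y _ 1) => n; rewrite mul1r.
  rewrite normrZ gtr0_norm ?invr_gt0// mulrC ler_pdivrMr//.
  have [_ [_ sx _] _ _] := wP (phi n); rewrite distrC; apply: (le_trans sx).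
  by rewrite ler_pM ?invr_ge0// lerDl.
have xE n : xbar + tau n *: u n = x n.
  by rewrite scalerA divff ?gt_eqF// scale1r addrC subrK.
have PxE n : P xbar + tau n *: xi n = P (x n).
  by rewrite scalerA divff ?gt_eqF// scale1r addrC subrK.
have sE n : P xbar + tau n *: d n = s n.
  by rewrite scalerA divff ?gt_eqF// scale1r addrC subrK.
have cs : s (phi n) @[n --> \oo] --> P xbar.
  have : P xbar + tau (phi n) *: d (phi n) @[n --> \oo] --> P xbar + 0 *: xi0.
    by apply: cvgD; [exact: cvg_cst|exact: cvgZ].
  by rewrite scale0r addr0; under eq_fun do rewrite sE.
exists u0, xi0, zeta0; split.
- split; last first.
    case=> u00 xi00.
    have : `|u (phi n)| + `|xi (phi n)| @[n --> \oo] --> `|u0| + `|xi0|.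
      by apply: cvgD; apply: cvg_norm.
    under eq_fun do rewrite norm_uxi.
    rewrite u00 xi00 !normr0 addr0 => /cvg_lim-/(_ (@Rhausdorff R)).
    by rewrite lim_cst// => /eqP; rewrite oner_eq0.
  split.
    exists (fun n => tau (phi n)), (fun n => u (phi n)); split => //.
    by under eq_fun do rewrite xE.
  exists (fun n => tau (phi n)), (fun n => d (phi n)); split => // n.
  by rewrite sE; have [_ _ []] := wP (phi n).
- have : `|zeta (phi n)| @[n --> \oo] --> `|zeta0| by exact: cvg_norm.
  under eq_fun do rewrite norm_zeta.
  by move=> /cvg_lim-/(_ (@Rhausdorff R)); rewrite lim_cst.
- exists (fun n => tau (phi n)), (fun n => (u (phi n), xi (phi n))),
    (fun n => (eta (phi n), - zeta (phi n))); split => //.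
    by apply: cvg_pair => //; exact: cvgN.
  move=> n; have [_ _ _] := wP (phi n); congr regular_normal_cone.
  by rewrite -[RHS]/(xbar + tau _ *: u _, P xbar + tau _ *: xi _) xE PxE.
- exists (fun n => tau (phi n)), (fun n => d (phi n)), (fun n => zeta (phi n)).
  by split => // n; rewrite sE; have [] := wP (phi n).
exists (fun n => u (phi n)), (fun n => s (phi n)), (fun n => zeta (phi n)),
  (fun n => tau (phi n)); split => // n.
split; first by have [] := wP (phi n).
exists `|P (x (phi n)) - s (phi n)| => //.
by rewrite xE scalerA divff ?gt_eqF// scale1r.
Qed.

(** * Contradiction with either normality condition *)

Theorem corollary4p1 (R : realType) (X Y : finHilbertType R)
    (m : nat) (e : m.-tuple Y) (he : is_orthogonal_basis e)
    (P : X -> Y) (Lambda : set Y) (xbar : X)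
    (hxbar : Lambda (P xbar))
    (hP : \forall x \near xbar, {for x, continuous P})
    (hLambda : exists2 r : R, 0 < r &
       closed (Lambda `&` closed_ball (P xbar) r))
    (hnormality : dir_pseudo_normality P Lambda xbar \/
                  dir_quasi_normality e P Lambda xbar) :
  metrically_subregular P Lambda xbar.
Proof.
have [r r0 clL] := hLambda; apply: contrapT => nreg.
have [u [xi [zeta [[Luxi uxi0] nz cod nor]]]] :=
  critical_multiplier _ _ _ _ _ _ _ hxbar hP r0 clL nreg.
move=> [u_ [s_ [zeta_ [t [cu cs cz [t_gt0 ct] Hk]]]]].
have zeta0 : zeta <> 0.
  by move=> z0; move: nz; rewrite z0 normr0 => /esym/eqP; rewrite oner_eq0.
(* The sign conditions involve the limit [zeta], whereas [P - s] is a multiple of [zeta_ k]. The two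
   agree in sign for large [k], since the products tend to [|zeta|^2 = 1] and to squares of nonzero
   coordinates. *)
pose good k := 0 < inner (zeta_ k) zeta /\ forall i : 'I_m,
  coordinate e zeta i <> 0 -> 0 < coordinate e zeta i * coordinate e (zeta_ k) i.
have [N _ HN] : \forall k \near \oo, good k.
  have cinner z : inner (zeta_ k) z @[k --> \oo] --> inner zeta z.
    exact: (cvg_comp _ _ cz (continuous_innerl z zeta)).
  near=> k; split; near: k.
    by apply: (cvgr_gt _ (cinner zeta)); rewrite innerE nz expr1n.
  apply: filter_forall => i.
  have [->|ci0] := eqVneq (coordinate e zeta i) 0; first by apply: nearW.
  have : coordinate e zeta i * coordinate e (zeta_ k) i @[k --> \oo] -->
      coordinate e zeta i * coordinate e zeta i.
    by apply: cvgM; [exact: cvg_cst|exact: cinner].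
  move=> /cvgr_gt -/(_ 0); rewrite -expr2 exprn_even_gt0// => /(_ ci0).
  by apply: filterS => k ? _.
(* Normality quantifies over every [k], so all sequences are shifted by [N]. *)
have shift (T : topologicalType) (a : nat -> T) (l : T) :
    a @ \oo --> l -> a (k + N)%N @[k --> \oo] --> l.
  by move=> al; exact: (cvg_comp _ _ (cvg_addnr N) al).
have goodN k : good (k + N)%N by apply: HN => /=; exact: leq_addl.
have t0 : to0pos (fun k => t (k + N)%N) by split=> //; exact: (shift R).
case: hnormality => /(_ _ _ Luxi uxi0); apply; exists zeta; split => //;
  exists (fun k => u_ (k + N)%N), (fun k => s_ (k + N)%N),
    (fun k => zeta_ (k + N)%N), (fun k => t (k + N)%N);
  split; do ?[exact: shift|exact: t0] => k;
  have [nk [a a0 eqk]] := Hk (k + N)%N; have [g1 g2] := goodN k; split => //.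
  by rewrite eqk innerC innerZl mulr_gt0.
move=> i /g2; rewrite /coordinate -innerNl -innerDl eqk innerZl.
by rewrite mulrCA => ?; rewrite mulr_gt0.
Unshelve. all: by end_near. Qed.
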